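(* Let $(X,\mathcal{U})$ be a $T_0$ bicomplete quasi-uniform space generated by a family $\mathcal{D}=\{d_\alpha\}_{\alpha\in A}$ of quasi-pseudometrics, and let $T\colon X\to X$ be a $\mathcal{D}$-contraction. Then $T$ has a unique fixed point $x^*\in X$ (that is, $Tx^*=x^*$). Moreover, for every $x_0\in X$ the sequence of iterates $(T^n x_0)_{n\ge 0}$ converges to $x^*$ in the symmetrisation $\mathcal{U}^s$.
   Context: $X$ is a non-empty set. A quasi-uniformity on $X$ is a filter $\mathcal{U}$ on $X\times X$ such that every $U\in\mathcal{U}$ contains the diagonal $\Delta_X$ and for every $U\in\mathcal{U}$ there is $V\in\mathcal{U}$ with $V\circ V\subseteq U$, where $V\circ V=\{(x,z):\exists y,\ (x,y)\in V,\ (y,z)\in V\}$. The pair $(X,\mathcal{U})$ is a quasi-uniform space. Put $U^{-1}=\{(x,y):(y,x)\in U\}$. The symmetrisation $\mathcal{U}^s$ is the uniformity generated by the entourages $U\cap U^{-1}$, $U\in\mathcal{U}$; convergence in $\mathcal{U}^s$ is convergence in its uniform topology. $\mathcal{U}$ is $T_0$ if the preorder $\bigcap\mathcal{U}:=\bigcap_{U\in\mathcal{U}}U$ is antisymmetric. $(X,\mathcal{U})$ is bicomplete if the uniform space $(X,\mathcal{U}^s)$ is complete (every net that is Cauchy for $\mathcal{U}^s$ converges in $\mathcal{U}^s$). A quasi-pseudometric on $X$ is a function $d\colon X\times X\to[0,\infty)$ with $d(x,x)=0$ and $d(x,z)\le d(x,y)+d(y,z)$. A family $\mathcal{D}$ of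 quasi-pseudometrics generates the quasi-uniformity having as subbase the sets $\{(x,y):d(x,y)<\varepsilon\}$, $d\in\mathcal{D}$, $\varepsilon>0$. A self-map $T\colon X\to X$ is a $\mathcal{D}$-contraction if there is a family $\{k_\alpha\}_{\alpha\in A}\subseteq[0,1)$ such that for every $\alpha\in A$ and all $x,y\in X$, $d_\alpha(Tx,Ty)\le k_\alpha d_\alpha(x,y)$ and $d_\alpha(Ty,Tx)\le k_\alpha d_\alpha(y,x)$. *)

(* Defs.v *)
From HB Require Import structures.
From mathcomp Require Import all_boot all_order all_algebra.
From mathcomp Require Import all_classical all_reals topology.

Set Implicit Arguments.
Unset Strict Implicit.
Unset Printing Implicit Defensive.

Import Order.TTheory GRing.Theory Num.Theory.

Local Open Scope classical_set_scope.
Local Open Scope ring_scope.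
Local Open Scope relation_scope.

Record quasi_uniformity (X : Type) := QuasiUniformity {
  qentourage : set_system (X * X) ;
  qentourage_filter : Filter qentourage ;
  qentourage_diagonal : forall E, qentourage E -> diagonal `<=` E ;
  qentourage_split : forall E, qentourage E ->
    exists2 V, qentourage V & V \; V `<=` E }.

(* The carrier X, equipped below with the uniformity generated by the sets
   E `&` E^-1, and with the topology of that uniformity. *)
Definition symmetrisation (X : Type) (U : quasi_uniformity X) : Type := X.

Section Symmetrisation.
Variables (X : choiceType) (U : quasi_uniformity X).
Local Notation S := (symmetrisation U).

Definition sym_entourage : set_system (S * S) :=
  filter_from (qentourage U) (fun E => E `&` E^-1).

Local Lemma sym_filter : Filter sym_entourage.
Proof.
have FU := qentourage_filter U.
apply: filter_from_filter; first by exists setT; exact: filterT.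
move=> E F EU FU'; exists (E `&` F); first exact: filterI.
by move=> [x y] [[? ?] [? ?]].
Qed.

Local Lemma sym_diagonal A : sym_entourage A -> diagonal `<=` A.
Proof.
move=> [E EU EA] [x y] /diagonalP <-.
by apply: EA; split; apply: (qentourage_diagonal EU).
Qed.

Local Lemma sym_inv A : sym_entourage A -> sym_entourage A^-1.
Proof. by move=> [E EU EA]; exists E => // -[x y] [? ?]; apply: EA. Qed.

Local Lemma sym_split A :
  sym_entourage A -> exists2 B, sym_entourage B & B \; B `<=` A.
Proof.
move=> [E EU EA]; have [V VU VE] := qentourage_split EU.
exists (V `&` V^-1); first by exists V.
move=> [x z] [y /= [xy yx] [yz zy]]; apply: EA.
by split; apply: VE; exists y.
Qed.

HB.instance Definition _ := Choice.on S.
HB.instance Definition _ :=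
  isUniform.Build S sym_filter sym_diagonal sym_inv sym_split.

End Symmetrisation.

Section Nets.

Definition directed_preorder (I : Type) (le : I -> I -> Prop) : Prop :=
  [/\ inhabited I,
      forall i, le i i,
      forall i j k, le i j -> le j k -> le i k
    & forall i j, exists2 k, le i k & le j k].

Definition net_tails (I : Type) (le : I -> I -> Prop) : set_system I :=
  filter_from setT (fun i => [set j | le i j]).

Lemma net_tails_filter (I : Type) (le : I -> I -> Prop) :
  directed_preorder le -> ProperFilter (net_tails le).
Proof.
move=> [[i0] lexx letr ledir]; apply: filter_from_proper.
  apply: filter_from_filter; first by exists i0.
  move=> i j _ _; have [k ik jk] := ledir i j.
  by exists k => // l kl; split; [exact: letr kl | exact: letr kl].
by move=> i _; exists i; exact: lexx.
Qed.

Definition net_complete (M : uniformType) : Prop :=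
  forall (I : Type) (le : I -> I -> Prop) (u : I -> M),
    directed_preorder le ->
    (forall E, entourage E ->
       exists i, forall j k, le i j -> le i k -> E (u j, u k)) ->
    exists x : M, u @ net_tails le --> x.

Lemma net_completeP (M : uniformType) :
  net_complete M <->
  (forall F : set_system M,
     ProperFilter F -> cauchy F -> exists x : M, F --> x).
Proof.
split=> [cM F PF cF|cM I le u dle cu]; last first.
  have PF := net_tails_filter dle.
  apply: cM => E /cu[i iE].
  exists (u @` [set j | le i j], u @` [set j | le i j]).
    by split; exists i => // j ij; exists j.
  by move=> [_ _] [/= [j ij <-] [k ik <-]]; exact: iE.
pose I := {Ax : set M * M | F Ax.1 /\ Ax.1 Ax.2}.
pose le (a b : I) := (sval b).1 `<=` (sval a).1.
pose u (a : I) : M := (sval a).2.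
have net_of A : F A -> exists a : I, (sval a).1 = A.
  move=> FA; have [x Ax] := filter_ex FA.
  by exists (exist _ (A, x) (conj FA Ax)).
have [||x ux] := cM I le u.
- split.
  + by have [a _] := net_of setT filterT; exists.
  + by move=> a; exact: subset_refl.
  + by move=> a b c ab bc; exact: subset_trans bc ab.
  + move=> a b; have FA := (svalP a).1; have FB := (svalP b).1.
    have [c cE] := net_of _ (filterI FA FB).
    by exists c; rewrite /le cE => y [].
- move=> E /cF[[A B] /= [FA FB] ABE].
  have [a aE] := net_of _ (filterI FA FB).
  exists a => b c; rewrite /le aE => ab ac; apply: ABE; split => /=.
    by have [] := ab _ (svalP b).2.
  by have [] := ac _ (svalP c).2.
exists x => A /ux[a _ aA].
apply: filterS (svalP a).1 => y ay.
exact: (aA (exist _ ((sval a).1, y) (conj (svalP a).1 ay))).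
Qed.

End Nets.

Definition qu_T0 (X : Type) (U : quasi_uniformity X) : Prop :=
  forall x y : X, (\bigcap_(E in qentourage U) E) (x, y) ->
    (\bigcap_(E in qentourage U) E) (y, x) -> x = y.

Definition bicomplete (X : choiceType) (U : quasi_uniformity X) : Prop :=
  net_complete (symmetrisation U).

Section QuasiPseudometrics.
Variables (R : realType) (X : choiceType).

Definition quasi_pseudometric (d : X -> X -> R) : Prop :=
  [/\ forall x y, 0 <= d x y,
      forall x, d x x = 0
    & forall x y z, d x z <= d x y + d y z].

Definition qpm_subbase (A : Type) (d : A -> X -> X -> R) :
    set_system (X * X) :=
  [set E | exists a, exists2 e : R,
     0 < e & E = [set xy | d a xy.1 xy.2 < e]].

Definition generated_by (A : Type) (d : A -> X -> X -> R)
    (U : quasi_uniformity X) : Prop :=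
  qentourage U = filter_from (finI_from (qpm_subbase d) id) id.

Definition D_contraction (A : Type) (d : A -> X -> X -> R) (T : X -> X) :
    Prop :=
  exists2 k : A -> R, (forall a, 0 <= k a < 1) &
    forall a x y, d a (T x) (T y) <= k a * d a x y /\
                  d a (T y) (T x) <= k a * d a y x.

End QuasiPseudometrics.

(* Main.v *)
(** Each symmetrised pseudometric s_a(x, y) = d_a(x, y) + d_a(y, x) is
    contracted by T with ratio k_a, and the s_a generate the symmetrisation.
    The Banach argument, run for every a separately, shows that an orbit is
    Cauchy; by bicompleteness it has a limit, and every s_a vanishes between
    that limit and its image, so the two coincide by T0. *)

Require Import Defs.
From mathcomp Require Import all_boot all_order all_algebra.
From mathcomp Require Import all_classical all_reals topology.
From mathcomp Require Import finmap normedtype sequences lra.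

Set Implicit Arguments.
Unset Strict Implicit.
Unset Printing Implicit Defensive.

Import Order.TTheory GRing.Theory Num.Theory.
Import numFieldNormedType.Exports.

Local Open Scope classical_set_scope.
Local Open Scope ring_scope.

Definition qpm_sym (R : realType) (X : Type) (d : X -> X -> R) (x y : X) : R :=
  d x y + d y x.

Lemma geometric_lt (R : realType) (k C e : R) :
  0 <= k < 1 -> 0 < e -> exists n, k ^+ n * C < e.
Proof.
move=> /andP[k0 k1] e0.
have : geometric C k @ \oo --> (0 : R) by apply: cvg_geometric; rewrite ger0_norm.
move=> /cvgr_lt/(_ _ e0)[n _ /(_ n (leqnn n))] /=.
by rewrite mulrC; exists n.
Qed.

Lemma lt_pos_eq0 (R : realType) (c : R) :
  0 <= c -> (forall e, 0 < e -> c < e) -> c = 0.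
Proof.
move=> c0 ce; apply/eqP; rewrite eq_le c0 andbT leNgt; apply/negP => /ce.
by rewrite ltxx.
Qed.

Section SymmetrisedQuasiPseudometric.
Variables (R : realType) (X : choiceType) (d : X -> X -> R).
Hypothesis d_qpm : quasi_pseudometric d.
Local Notation s := (qpm_sym d).

Lemma qpm_sym_ge0 x y : 0 <= s x y.
Proof. by have [d0 _ _] := d_qpm; rewrite addr_ge0. Qed.

Lemma qpm_symC x y : s x y = s y x.
Proof. exact: addrC. Qed.

Lemma qpm_sym_triangle y x z : s x z <= s x y + s y z.
Proof.
have [_ _ tri] := d_qpm.
by have := tri x y z; have := tri z y x; rewrite /qpm_sym; lra.
Qed.

Lemma qpm_le_sym x y : d x y <= s x y.
Proof. by have [d0 _ _] := d_qpm; rewrite lerDl. Qed.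

Variables (T : X -> X) (k : R).
Hypothesis k01 : 0 <= k < 1.
Hypothesis Tk : forall x y, s (T x) (T y) <= k * s x y.

Lemma contraction_iter n x y :
  s (iter n T x) (iter n T y) <= k ^+ n * s x y.
Proof.
have /andP[k0 _] := k01.
elim: n => [|n IHn] /=; first by rewrite mul1r.
by rewrite exprS -mulrA (le_trans (Tk _ _))// ler_wpM2l.
Qed.

(** The bound is the fixed point of [c |-> s x (T x) + k * c], so induction with one triangle
    through [T x] preserves it and no geometric sum is needed. *)
Lemma contraction_orbit_bounded n x :
  s x (iter n T x) <= s x (T x) / (1 - k).
Proof.
have /andP[k0 k1] := k01; have k1' : 0 < 1 - k by rewrite subr_gt0.
rewrite ler_pdivlMr//.
elim: n => [|n IHn] /=.
  have [_ d0 _] := d_qpm.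
  by rewrite {1}/qpm_sym !d0 addr0 mul0r qpm_sym_ge0.
apply: (@le_trans _ _ ((s x (T x) + k * s x (iter n T x)) * (1 - k))).
  rewrite ler_wpM2r ?(ltW k1')//.
  by rewrite (le_trans (qpm_sym_triangle (T x) _ _))// lerD2l Tk.
have := ler_wpM2l k0 IHn; lra.
Qed.

(** Beyond index [n] two iterates are images under the [n]-th iterate of [T] of orbit points. These
    lie within [C] of [x], hence within [C + C] of each other, and the distance shrinks by
    [k ^+ n]. *)
Lemma contraction_orbit_cauchy x e : 0 < e ->
  exists n, forall p q, (n <= p)%N -> (n <= q)%N ->
    s (iter p T x) (iter q T x) < e.
Proof.
move=> e0; have /andP[k0 _] := k01; set C := s x (T x) / (1 - k).
have [n ne] := geometric_lt (C + C) k01 e0.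
exists n => p q np nq; apply: le_lt_trans ne.
rewrite -(subnKC np) -(subnKC nq) !iterD.
apply: le_trans (contraction_iter _ _ _) _.
rewrite ler_wpM2l ?exprn_ge0// (le_trans (qpm_sym_triangle x _ _))//.
by rewrite qpm_symC lerD// contraction_orbit_bounded.
Qed.

Lemma contraction_fixed_qpm_sym0 x y : T x = x -> T y = y -> s x y = 0.
Proof.
move=> Tx Ty; have /andP[_ k1] := k01.
have := Tk x y; rewrite Tx Ty; have := qpm_sym_ge0 x y; nra.
Qed.

End SymmetrisedQuasiPseudometric.

Section GeneratedQuasiUniformity.
Variables (R : realType) (X : choiceType) (U : quasi_uniformity X).
Variables (A : Type) (d : A -> X -> X -> R).
Hypothesis d_qpm : forall a, quasi_pseudometric (d a).
Hypothesis U_gen : generated_by d U.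

Lemma qentourage_qpm_lt a e :
  0 < e -> qentourage U [set xy | d a xy.1 xy.2 < e].
Proof.
move=> e0; rewrite U_gen; exists [set xy | d a xy.1 xy.2 < e] => //.
by apply: finI_from1; exists a, e.
Qed.

Lemma sym_entourage_qpm_sym_lt a e : 0 < e ->
  @entourage (symmetrisation U) [set xy | qpm_sym (d a) xy.1 xy.2 < e].
Proof.
move=> e0; have e20 : 0 < e / 2 by rewrite divr_gt0.
exists [set xy | d a xy.1 xy.2 < e / 2]; first exact: qentourage_qpm_lt.
by move=> [x y] [/= xy yx]; rewrite /qpm_sym; lra.
Qed.

(* Taking for [G] an image filter or a principal filter turns statements about
   all entourages of the symmetrisation into statements about each [d a]. *)
Lemma sym_entourage_sub_filter (G : set_system (X * X)) : Filter G ->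
  (forall a e, 0 < e -> G [set xy | qpm_sym (d a) xy.1 xy.2 < e]) ->
  @entourage (symmetrisation U) `<=` G.
Proof.
move=> FG Gs E [V]; rewrite U_gen => -[_ [D DU <-] DV] VE.
(* [V] contains a finite intersection of subbasic sets. Since [qpm_sym (d a)] dominates [d a] in
   both orders, [G] contains each of these sets and its inverse. *)
suff [GV GV'] : G (\bigcap_(W in [set` D]) W) /\
    G (\bigcap_(W in [set` D]) W^-1)%relation.
  apply: filterS VE _; apply: filterI; first exact: filterS DV GV.
  by apply: filterS GV' => -[x y] Wyx; apply: DV => W /Wyx.
split; apply: filter_bigI => W /DU/set_mem[a [e e0 ->]];
  apply: filterS (Gs a e e0) => -[x y] /=; apply: le_lt_trans.
  exact: qpm_le_sym.
by rewrite qpm_symC; exact: qpm_le_sym.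
Qed.

Lemma cvg_symmetrisation (F : set_system (symmetrisation U)) (x : X) :
  Filter F ->
  (F --> (x : symmetrisation U)) <->
  (forall a e, 0 < e -> \forall y \near F, qpm_sym (d a) x y < e).
Proof.
move=> FF; split=> [Fx a e e0|Fx].
  exact: (cvg_entourage Fx (sym_entourage_qpm_sym_lt a e0)).
apply/cvg_entourageP => E.
(* [E] belongs to this image filter exactly when [E (x, y)] holds for [y] near [F]. *)
apply: (@sym_entourage_sub_filter (pair x @ F)) => a e e0.
exact: Fx.
Qed.

Lemma qpm_sym0_eq x y :
  qu_T0 U -> (forall a, qpm_sym (d a) x y = 0) -> x = y.
Proof.
move=> T0 xy.
have ent E : qentourage U E -> E (x, y) /\ E (y, x).
  move=> UE; have sE : @entourage (symmetrisation U) (E `&` E^-1)%relation.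
    by exists E.
  (* The principal filter at [(x, y)] contains every symmetrised ball, because [0 < e]. *)
  apply/(principal_filterP _ (E `&` E^-1)%relation).
  apply: sym_entourage_sub_filter sE.
  by move=> a e e0; apply/principal_filterP; rewrite /= xy.
by apply: T0 => E UE; have [] := ent E UE.
Qed.

End GeneratedQuasiUniformity.

Theorem theorem4p2 (R : realType) (X : choiceType) (X_neq0 : [set: X] !=set0)
    (U : quasi_uniformity X) (A : Type) (d : A -> X -> X -> R) (T : X -> X)
    (d_qpm : forall a : A, quasi_pseudometric (d a))
    (U_gen : generated_by d U) (U_T0 : qu_T0 U) (U_bicomplete : bicomplete U)
    (T_contraction : D_contraction d T) :
  exists xs : X,
    [/\ T xs = xs,
        forall y : X, T y = y -> y = xs
      & forall x0 : X,
          (iter n T x0 : symmetrisation U) @[n --> \oo]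
            --> (xs : symmetrisation U)].
Proof.
have [k k01 Tk] := T_contraction.
have Ts a x y : qpm_sym (d a) (T x) (T y) <= k a * qpm_sym (d a) x y.
  by rewrite /qpm_sym mulrDr; have [? ?] := Tk a x y; exact: lerD.
have [x0 _] := X_neq0.
have [||xs xs_lim] := U_bicomplete nat (fun m n => (m <= n)%N)
    (fun n => iter n T x0).
- split=> //; [exact: (inhabits 0%N) | by move=> m n p; exact: leq_trans|].
  by move=> m n; exists (maxn m n); rewrite ?leq_maxl ?leq_maxr.
(* The image of [(\oo, \oo)] under pairs of iterates encodes the Cauchy condition, which can then be
   checked for each [a] with its own ratio [k a]. *)
- move=> E /(sym_entourage_sub_filter d_qpm U_gen
    (G := (fun mn => (iter mn.1 T x0, iter mn.2 T x0)) @ (\oo, \oo))).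
  case=> [a e e0|[P Q] /= [[m _ mP] [n _ nQ]] PQ].
    have [n nP] := contraction_orbit_cauchy (d_qpm a) (k01 a) (Ts a) x0 e0.
    exists ([set m | (n <= m)%N], [set m | (n <= m)%N]).
      by split; exists n.
    by move=> [p q] [/= np nq]; exact: nP.
  exists (maxn m n) => p q; rewrite !geq_max => /andP[mp _] /andP[_ nq].
  by apply: (PQ (p, q)); split; [exact: mP | exact: nQ].
(* The tails of the net indexed by [nat] are by definition the filter [\oo]. *)
have {}xs_lim : (iter n T x0 : symmetrisation U) @[n --> \oo]
  --> (xs : symmetrisation U) := xs_lim.
have Txs : T xs = xs.
  apply: (qpm_sym0_eq d_qpm U_gen U_T0) => a.
  apply: lt_pos_eq0 => [|e e0]; first exact: qpm_sym_ge0.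
  have e20 : 0 < e / 2 by rewrite divr_gt0.
  have [n _ nP] := (cvg_symmetrisation d_qpm U_gen _ _).1 xs_lim a _ e20.
  have := nP n (leqnn n); have := nP n.+1 (leqnSn n) => /= xSn xn.
  have /andP[k0 k1] := k01 a.
  (* Through the next iterate, both legs are below [e / 2]: one by contracting the distance at [n],
     the other by convergence at [n.+1]. *)
  have := qpm_sym_triangle (d_qpm a) (T (iter n T x0)) (T xs) xs.
  have := Ts a xs (iter n T x0).
  rewrite [qpm_sym _ (T (iter _ _ _)) xs]qpm_symC.
  have := qpm_sym_ge0 (d_qpm a) xs (iter n T x0).
  nra.
exists xs; split=> // [y Ty|x].
  apply: (qpm_sym0_eq d_qpm U_gen U_T0) => a.
  exact (contraction_fixed_qpm_sym0 (d_qpm a) (k01 a) (Ts a) Ty Txs).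
apply/(cvg_symmetrisation d_qpm U_gen) => a e e0.
have /andP[k0 k1] := k01 a.
have [n ne] := geometric_lt (qpm_sym (d a) xs x) (k01 a) e0.
exists n => // m /= nm; apply: le_lt_trans ne.
(* The orbit of [xs] is constant, so the distance to be bounded is one between two [m]-th
   iterates. *)
have iter_xs : iter m T xs = xs by elim: m {nm} => //= m ->.
rewrite -{1}iter_xs (le_trans (contraction_iter (k01 a) (Ts a) _ _ _))//.
by rewrite ler_wpM2r ?qpm_sym_ge0// ler_wiXn2l// ltW.
Qed.
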